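(* For any finite sets of formulas $\Psi,\Phi$, i.e. for any second level sequent $\Psi\Rrightarrow\Phi$, the following six conditions are equivalent. \begin{enumerate} \item There is a finite set $\Sigma$ of formulas such that for any GL-model $\langle W,R,V\rangle$ and any $\Sigma$-reflexive world $w\in W$, $V(w,(\Psi\Rrightarrow\Phi))=\mathsf{true}$. \item For any GL-model $\langle W,R,V\rangle$, there is a finite set $\Sigma$ of formulas such that for any $\Sigma$-reflexive world $w\in W$, $V(w,(\Psi\Rrightarrow\Phi))=\mathsf{true}$. \item For any GL-model $\langle W,R,V\rangle$ and any infinitely descending sequence $w_1R^{-1}w_2R^{-1}w_3\cdots$ in $W$, there is a number $i$ such that for any $j\ge i$, $V(w_j,(\Psi\Rrightarrow\Phi))=\mathsf{true}$. \item For any GL-model $\langle W,R,V\rangle$ and any infinitely descending sequence $w_1R^{-1}w_2R^{-1}w_3\cdots$ in $W$, there is a number $i$ such that $V(w_i,(\Psi\Rrightarrow\Phi))=\mathsf{true}$. \item $\Psi\Rrightarrow\Phi$ is provable in $\mathbf{GLS}_{\rm seq}$ without using the rule (cut) (at either level). \item $\Psi\Rrightarrow\Phi$ is provable in $\mathbf{GLS}_{\rm seq}$. \end{enumerate}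
   Context: Formulas are built from propositional variables, the constant $\bot$, the binary connective $\to$, and the unary modal operator $\Box$. Let $\mathsf{Fml}$ be the set of all formulas. For a set $\Gamma$ of formulas, $\Box\Gamma=\{\Box\gamma\mid\gamma\in\Gamma\}$. Sequents. For finite sets $\Gamma,\Delta$ of formulas, $\Gamma\Rightarrow\Delta$ is a first level sequent and $\Gamma\Rrightarrow\Delta$ is a second level sequent. Commas denote union and a formula stands for its singleton (so $\varphi,\Gamma$ means $\{\varphi\}\cup\Gamma$). The sequent calculus $\mathbf{GLS}_{\rm seq}$ derives sequents of both levels. Below, $\blacktriangleright$ stands for either $\Rightarrow$ or $\Rrightarrow$, with the same choice throughout each rule. - Initial sequents: $\varphi\blacktriangleright\varphi$ (any formula $\varphi$) and $\bot\blacktriangleright$ (empty right side). - (cut): from $\Gamma\blacktriangleright\Delta,\varphi$ and $\varphi,\Gamma\blacktriangleright\Delta$ infer $\Gamma\blacktriangleright\Delta$. - (weakening): from $\Gamma\blacktriangleright\Delta$ infer $\Gamma'\blacktriangleright\Delta'$, where $\Gamma\subseteq\Gamma'$ and $\Delta\subseteq\Delta'$. - ($\to$L): from $\Gamma\blacktriangleright\Delta,\varphi$ and $\psi,\Gamma\blacktriangleright\Delta$ infer $\varphi\to\psi,\Gamma\blacktriangleright\Delta$. - ($\to$R): from $\varphi,\Gamma\blacktriangleright\Delta,\psi$ infer $\Gamma\blacktriangleright\Delta,\varphi\to\psi$. - ($\Box_{\rm GL}$), first level only: from $\Gamma,\Box\Gamma,\Box\varphi\Rightarrow\varphi$ infer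 $\Box\Gamma\Rightarrow\Box\varphi$. - ($\Box$L), second level only: from $\varphi,\Gamma\Rrightarrow\Delta$ infer $\Box\varphi,\Gamma\Rrightarrow\Delta$. - ($\Rightarrow\Rrightarrow$): from $\Gamma\Rightarrow\Delta$ infer $\Gamma\Rrightarrow\Delta$. GL-models. A GL-model is a triple $\langle W,R,V\rangle$ where $W$ is a non-empty set (of worlds), $R\subseteq W\times W$ is transitive, there is no infinite ascending sequence $x_1Rx_2Rx_3\cdots$, and $V:W\times\mathsf{Fml}\to\{\mathsf{true},\mathsf{false}\}$ satisfies: $V(w,\bot)=\mathsf{false}$; $V(w,\varphi\to\psi)=\mathsf{true}$ iff $V(w,\varphi)=\mathsf{false}$ or $V(w,\psi)=\mathsf{true}$; $V(w,\Box\varphi)=\mathsf{true}$ iff $V(w',\varphi)=\mathsf{true}$ for all $w'$ with $wRw'$. Truth of sequents: $V(w,(\Gamma\blacktriangleright\Delta))=\mathsf{true}$ iff $V(w,\gamma)=\mathsf{false}$ for some $\gamma\in\Gamma$ or $V(w,\delta)=\mathsf{true}$ for some $\delta\in\Delta$. For a set $\Sigma$ of formulas, a world $w$ is $\Sigma$-reflexive iff $V(w,\Box\alpha\to\alpha)=\mathsf{true}$ for every formula of the form $\Box\alpha$ in $\Sigma$. An infinitely descending sequence $w_1R^{-1}w_2R^{-1}w_3\cdots$ is a sequence $(w_n)_{n\ge1}$ of worlds with $w_{n+1}Rw_n$ for all $n\ge1$. *)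

(* Defs.v *)
From HB Require Import structures.
From mathcomp Require Import all_boot finmap.
Set Implicit Arguments.
Unset Strict Implicit.
Unset Printing Implicit Defensive.

Local Open Scope fset_scope.

Inductive form : Type :=
  | Var of nat
  | Bot
  | Imp of form & form
  | Box of form.

(* Encoding into trees, used only to make [form] a countType (hence a
   choiceType), as finite sets over it require. *)
Fixpoint form_encode (a : form) : GenTree.tree nat :=
  match a with
  | Var n => GenTree.Leaf n
  | Bot => GenTree.Node 0 [::]
  | Imp b c => GenTree.Node 1 [:: form_encode b; form_encode c]
  | Box b => GenTree.Node 2 [:: form_encode b]
  end.

Fixpoint form_decode (t : GenTree.tree nat) : form :=
  match t with
  | GenTree.Leaf n => Var n
  | GenTree.Node 1 [:: t1; t2] => Imp (form_decode t1) (form_decode t2)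
  | GenTree.Node 2 [:: t1] => Box (form_decode t1)
  | _ => Bot
  end.

Lemma form_encodeK : cancel form_encode form_decode.
Proof. by elim=> [n||a IHa b IHb|a IHa] //=; rewrite ?IHa ?IHb. Qed.

HB.instance Definition _ := Countable.copy form (can_type form_encodeK).

Definition boxes (G : {fset form}) : {fset form} := [fset Box a | a in G].

Inductive level : Type := First | Second.

Record sequent : Type := Sequent {
  slevel : level;
  sante : {fset form};
  ssucc : {fset form}
}.

Notation "G ==>1 D" := (Sequent First G D) (at level 70, no associativity).
Notation "G ==>2 D" := (Sequent Second G D) (at level 70, no associativity).

(* [GLSseq true] is provability in the full calculus, [GLSseq false] is
   provability by derivations in which (cut) occurs at neither level.
   In each rule the context may already contain the displayed formulas, since
   the comma is union of sets. *)
Inductive GLSseq (with_cut : bool) : sequent -> Prop :=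
  | GLS_id l a :
      GLSseq with_cut (Sequent l [fset a] [fset a])
  | GLS_bot l :
      GLSseq with_cut (Sequent l [fset Bot] fset0)
  | GLS_cut l G D a :
      with_cut ->
      GLSseq with_cut (Sequent l G (D `|` [fset a])) ->
      GLSseq with_cut (Sequent l (a |` G) D) ->
      GLSseq with_cut (Sequent l G D)
  | GLS_weak l G D G' D' :
      G `<=` G' -> D `<=` D' ->
      GLSseq with_cut (Sequent l G D) ->
      GLSseq with_cut (Sequent l G' D')
  | GLS_impL l G D a b :
      GLSseq with_cut (Sequent l G (D `|` [fset a])) ->
      GLSseq with_cut (Sequent l (b |` G) D) ->
      GLSseq with_cut (Sequent l (Imp a b |` G) D)
  | GLS_impR l G D a b :
      GLSseq with_cut (Sequent l (a |` G) (D `|` [fset b])) ->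
      GLSseq with_cut (Sequent l G (D `|` [fset Imp a b]))
  | GLS_boxGL G a :
      GLSseq with_cut (G `|` boxes G `|` [fset Box a] ==>1 [fset a]) ->
      GLSseq with_cut (boxes G ==>1 [fset Box a])
  | GLS_boxL G D a :
      GLSseq with_cut (a |` G ==>2 D) ->
      GLSseq with_cut (Box a |` G ==>2 D)
  | GLS_lift G D :
      GLSseq with_cut (G ==>1 D) ->
      GLSseq with_cut (G ==>2 D).

Definition GLSseq_provable (S : sequent) : Prop := GLSseq true S.
Definition GLSseq_cutfree_provable (S : sequent) : Prop := GLSseq false S.

Record GLmodel : Type := {
  world :> Type;
  world_nonempty : inhabited world;
  acc : world -> world -> Prop;
  acc_trans : forall x y z, acc x y -> acc y z -> acc x z;
  acc_noetherian : ~ exists x : nat -> world, forall n, acc (x n) (x n.+1);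
  val_of : world -> form -> bool;
  val_bot : forall w, val_of w Bot = false;
  val_imp : forall w a b,
    val_of w (Imp a b) = true <-> val_of w a = false \/ val_of w b = true;
  val_box : forall w a,
    val_of w (Box a) = true <-> forall w', acc w w' -> val_of w' a = true
}.

Definition sequent_true (M : GLmodel) (w : M) (S : sequent) : Prop :=
  (exists2 a, a \in sante S & val_of w a = false) \/
  (exists2 a, a \in ssucc S & val_of w a = true).

Definition reflexive_at (Sigma : {fset form}) (M : GLmodel) (w : M) : Prop :=
  forall a, Box a \in Sigma -> val_of w (Imp (Box a) a) = true.

(* Sequences are indexed from 0 rather than from 1. *)
Definition descending (M : GLmodel) (w : nat -> M) : Prop :=
  forall n, acc (w n.+1) (w n).

(* Main.v *)
(** Only the passage from the semantic conditions to cut-free provability needs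
    a construction.  If a second level sequent has no cut-free proof, extend it
    inside a finite subformula-closed set to a maximal cut-free-unprovable pair
    [p0].  The maximal pairs of the first level form a canonical GL-model, and
    below it one adds an infinite descending chain of copies of [p0], each of
    which sees the earlier copies and the successors of [p0].  The boxed
    formulas on the left of [p0] stay true at the copies because ([Box]L) puts
    their bodies on the left of [p0] too, so every copy refutes the sequent.  In
    the other direction, along a descending sequence [Box a] is either true
    everywhere or eventually false, so [Box a -> a] eventually holds. *)
Require Import Defs.
From mathcomp Require Import all_boot finmap boolp.
Set Implicit Arguments.
Unset Strict Implicit.
Unset Printing Implicit Defensive.

Local Open Scope fset_scope.

(** * Finite sets and induction along accessibility *)

Lemma boxes_mem (G : {fset form}) a : (Box a \in boxes G) = (a \in G).
Proof.
apply/imfsetP/idP => [[b /= bG [->]] //|aG].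
by exists a.
Qed.

Lemma fcard_ltn (A B : {fset form}) a :
  A `<=` B -> a \in B -> a \notin A -> #|` A| < #|` B|.
Proof.
move=> AB aB aA; apply: fproper_ltn_card; rewrite fproperE AB.
by apply: contra aA => /fsubsetP; apply.
Qed.

Lemma no_descending_nat (f : nat -> nat) : ~ forall n, f n.+1 < f n.
Proof.
move=> fd; have bound n : f n + n <= f 0.
  elim: n => [|n IHn]; first by rewrite addn0.
  by rewrite addnS; apply: leq_trans IHn; rewrite ltn_add2r.
by have := bound (f 0).+1; rewrite addnS ltnNge leq_addl.
Qed.

(** A counterexample always has a successor that is again one, so iterating a choice of successors
    would yield an infinite ascending sequence. *)
Lemma GLmodel_ind (M : GLmodel) (P : M -> Prop) :
  (forall x, (forall y, acc x y -> P y) -> P x) -> forall x, P x.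
Proof.
move=> IH x0; apply: contrapT => nPx0.
have next x : exists y, ~ P x -> acc x y /\ ~ P y.
  have [Px|nPx] := EM (P x); first by exists x.
  apply: contrapT => noy; apply: nPx; apply: IH => y xy.
  by apply: contrapT => nPy; apply: noy; exists y.
have [f fP] := choice next.
have nP n : ~ P (iter n f x0) by elim: n => //= n /fP[].
apply: (@acc_noetherian M); exists (fun n => iter n f x0) => n.
by have [] := fP _ (nP n).
Qed.

(** Semantic Löb principle, needed for [GLS_boxGL]. By transitivity the successors of [v] are
    successors of [w], so the induction hypothesis makes [Box a] true at [v]. *)
Lemma val_box_loeb (M : GLmodel) (w : M) a :
  (forall v, acc w v -> val_of v (Box a) = true -> val_of v a = true) ->
  val_of w (Box a) = true.
Proof.
move=> H; apply/val_box => v; move: v.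
apply: GLmodel_ind => v IHv wv; apply: H => //.
by apply/val_box => u vu; apply: IHv => //; apply: acc_trans vu.
Qed.

Lemma sequent_trueP (M : GLmodel) (w : M) l G D :
  sequent_true w (Sequent l G D) <->
  ((forall a, a \in G -> val_of w a = true) ->
   exists2 a, a \in D & val_of w a = true).
Proof.
split=> [[[a aG wa] wG|//]|H]; first by rewrite wG in wa.
have [wG|] := EM (forall a, a \in G -> val_of w a = true).
  by right; apply: H.
move=> /existsNP[a /not_implyP[aG /negP wa]]; left; exists a => //.
exact: negbTE.
Qed.

(** * Cut-free derivations as derivations, and soundness *)

Lemma GLSseq_cut_mono (b : bool) S : GLSseq false S -> GLSseq b S.
Proof.
elim=> {S} //.
- exact: GLS_id.
- exact: GLS_bot.
- by move=> l G D G' D' GG' DD' _; apply: GLS_weak.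
- by move=> l G D a c _ prL _ prR; apply: GLS_impL.
- by move=> l G D a c _; apply: GLS_impR.
- by move=> G a _; apply: GLS_boxGL.
- by move=> G D a _; apply: GLS_boxL.
- by move=> G D _; apply: GLS_lift.
Qed.

(** Reflexivity is demanded only at the second level: a first level sequent must hold at every world
    for [GLS_boxGL] to be sound. *)
Definition valid_at (S : sequent) (Sigma : {fset form}) (M : GLmodel) (w : M) :=
  (if slevel S is Second then reflexive_at Sigma w else True) ->
  sequent_true w S.

Lemma reflexive_atS (Sigma Sigma' : {fset form}) (M : GLmodel) (w : M) :
  Sigma `<=` Sigma' -> reflexive_at Sigma' w -> reflexive_at Sigma w.
Proof. by move=> /fsubsetP sub refl a /sub/refl. Qed.

Lemma valid_atS S (Sigma Sigma' : {fset form}) (M : GLmodel) (w : M) :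
  Sigma `<=` Sigma' -> valid_at S Sigma w -> valid_at S Sigma' w.
Proof.
rewrite /valid_at; case: (slevel S) => // sub H refl.
exact/H/(reflexive_atS sub).
Qed.

(** [Sigma] collects the boxed formulas introduced by [GLS_boxL] in the derivation; two-premise
    rules take the union. *)
Lemma GLSseq_sound b S :
  GLSseq b S -> exists Sigma, forall (M : GLmodel) (w : M), valid_at S Sigma w.
Proof.
elim=> {S}.
- move=> l a; exists fset0 => M w _; apply/sequent_trueP => H.
  by exists a; [rewrite inE | apply: H; rewrite inE].
- move=> l; exists fset0 => M w _; apply/sequent_trueP => /(_ Bot).
  by rewrite val_bot inE eqxx => /(_ isT).
- move=> l G D a _ _ [S1 H1] _ [S2 H2]; exists (S1 `|` S2) => M w refl.
  apply/sequent_trueP => wG.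
  have /sequent_trueP/(_ wG)[c] := valid_atS (fsubsetUl S1 S2) (H1 M w) refl.
  rewrite !inE => /orP[cD wc|/eqP-> wa]; first by exists c.
  have /sequent_trueP := valid_atS (fsubsetUr S1 S2) (H2 M w) refl.
  by apply=> d; rewrite !inE => /orP[/eqP->|/wG].
- move=> l G D G' D' /fsubsetP GG' /fsubsetP DD' _ [S1 H1].
  exists S1 => M w refl; apply/sequent_trueP => wG.
  have /sequent_trueP[|c /DD' cD wc] := H1 M w refl; last by exists c.
  by move=> c /GG'/wG.
- move=> l G D a b' _ [S1 H1] _ [S2 H2]; exists (S1 `|` S2) => M w refl.
  apply/sequent_trueP => wG.
  have /sequent_trueP[|c] := valid_atS (fsubsetUl S1 S2) (H1 M w) refl.
    by move=> c cG; apply: wG; rewrite !inE cG orbT.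
  rewrite !inE => /orP[cD wc|/eqP-> wa]; first by exists c.
  have /sequent_trueP := valid_atS (fsubsetUr S1 S2) (H2 M w) refl.
  apply=> d; rewrite !inE => /orP[/eqP->|dG]; last first.
    by apply: wG; rewrite !inE dG orbT.
  have /val_imp[] // : val_of w (Imp a b') = true.
    by apply: wG; rewrite !inE eqxx.
  by rewrite wa.
- move=> l G D a b' _ [S1 H1]; exists S1 => M w refl.
  apply/sequent_trueP => wG.
  have [wi|nwi] := EM (val_of w (Imp a b') = true).
    by exists (Imp a b') => //; rewrite !inE eqxx orbT.
  have /sequent_trueP[|c] := H1 M w refl.
    move=> c; rewrite !inE => /orP[/eqP->|/wG//].
    apply: contrapT => /negP/negbTE wa; apply: nwi.
    by apply/val_imp; left.
  rewrite !inE => /orP[cD wc|/eqP-> wb]; first by exists c; rewrite // inE cD.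
  by case: nwi; apply/val_imp; right.
- move=> G a _ [S1 H1]; exists S1 => M w _.
  apply/sequent_trueP => wG; exists (Box a); first by rewrite inE.
  apply: val_box_loeb => v wv va.
  (* The first level premise may be used at the successor [v], of which no reflexivity is known. *)
  have /sequent_trueP[|c] := H1 M v I; last by rewrite inE => /eqP->.
  have GP c : c \in G -> val_of v c = true /\ val_of v (Box c) = true.
    rewrite -boxes_mem => /wG/val_box wc; split; first exact: wc.
    by apply/val_box => u vu; apply/wc/(acc_trans wv).
  move=> c; rewrite !inE -orbA.
  by case/or3P => [/GP[]//|/imfsetP[d /= /GP[_ vd] ->]//|/eqP->].
- move=> G D a _ [S1 H1]; exists (Box a |` S1) => M w refl.
  apply/sequent_trueP => wG.
  have /sequent_trueP := valid_atS (fsubsetU1 (Box a) S1) (H1 M w) refl.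
  apply=> c; rewrite !inE => /orP[/eqP->|cG]; last first.
    by apply: wG; rewrite !inE cG orbT.
  have /val_imp[] // : val_of w (Imp (Box a) a) = true.
    by apply: refl; rewrite !inE eqxx.
  by rewrite wG // !inE eqxx.
- by move=> G D _ [S1 H1]; exists S1 => M w _; apply: (H1 M w).
Qed.

(** * Reflexivity along descending sequences *)

Lemma descending_lt (M : GLmodel) (w : nat -> M) :
  descending w -> forall i j, i < j -> acc (w j) (w i).
Proof.
move=> dw i; elim=> // j IHj; rewrite ltnS leq_eqVlt => /orP[/eqP->//|/IHj].
exact: acc_trans.
Qed.

(** If [Box a] fails at [w i], it fails at all later worlds, since they see whatever [w i] sees. If
    it never fails, [a] holds at [w j] because [w j.+1] sees it. *)
Lemma descending_reflexive1 (M : GLmodel) (w : nat -> M) a : descending w ->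
  exists i, forall j, i <= j -> val_of (w j) (Imp (Box a) a) = true.
Proof.
move=> dw.
have [wa|/existsNP[i /negP/negbTE wi]] :=
  EM (forall i, val_of (w i) (Box a) = true).
  exists 0 => j _; apply/val_imp; right.
  by have /val_box := wa j.+1; apply; apply: dw.
exists i => j; rewrite leq_eqVlt => /orP[/eqP<-|ij].
  by apply/val_imp; left.
apply/val_imp; left; apply: contraFF wi => /val_box wj; apply/val_box => v iv.
by apply: wj; apply: acc_trans iv; apply: descending_lt.
Qed.

Lemma descending_reflexive (M : GLmodel) (w : nat -> M) (Sigma : {fset form}) :
  descending w -> exists i, forall j, i <= j -> reflexive_at Sigma (w j).
Proof.
move=> dw.
have [f fP] := choice (fun a => descending_reflexive1 a dw).
(* The maximum of the individual thresholds; formulas that are not boxed contribute the neutral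
   value 0. *)
exists (\max_(c <- Sigma) (if c is Box a then f a else 0)) => j le_j a aS.
apply: fP; apply: leq_trans le_j.
pose F c := if c is Box b then f b else 0.
exact: (@leq_bigmax_seq _ _ xpredT F _ aS).
Qed.

(** * Finite subformula-closed sets *)

Definition subform_closed (S : {fset form}) : Prop :=
  (forall a b, Imp a b \in S -> a \in S /\ b \in S) /\
  (forall a, Box a \in S -> a \in S).

Lemma subform_closedU S T :
  subform_closed S -> subform_closed T -> subform_closed (S `|` T).
Proof.
move=> [S1 S2] [T1 T2]; split=> [a b|a]; rewrite !inE.
  by case/orP => [/S1|/T1] [-> ->]; rewrite ?orbT.
by case/orP => [/S2|/T2] ->; rewrite ?orbT.
Qed.

Lemma subform_closed1 a : exists2 S, subform_closed S & a \in S.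
Proof.
elim: a => [n||a [S clS aS] b [T clT bT]|a [S [S1 S2] aS]].
- exists [fset Var n]; last by rewrite inE.
  by split=> [c d|c]; rewrite inE.
- exists [fset Bot]; last by rewrite inE.
  by split=> [c d|c]; rewrite inE.
- have [U1 U2] := subform_closedU clS clT.
  exists (Imp a b |` (S `|` T)); last by rewrite !inE eqxx.
  split=> [c d|c]; rewrite in_fset1U.
    case/orP => [/eqP[-> ->]|/U1[cU dU]]; first by rewrite !inE aS bT !orbT.
    by rewrite !in_fset1U cU dU !orbT.
  by case/orP => [/eqP//|/U2 cU]; rewrite in_fset1U cU orbT.
- exists (Box a |` S); last by rewrite !inE eqxx.
  split=> [c d|c]; rewrite !inE.
    by case/orP => [/eqP//|/S1[-> ->]]; rewrite !orbT.
  by case/orP => [/eqP[->]|/S2->]; rewrite ?aS ?orbT.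
Qed.

Lemma subform_closure (G : {fset form}) :
  exists2 S, subform_closed S & G `<=` S.
Proof.
suff [S clS sub] : exists2 S, subform_closed S & {subset (G : seq form) <= S}.
  by exists S => //; apply/fsubsetP.
elim: (G : seq form) => [|a s [S clS sS]].
  by exists fset0 => //; split=> [c d|c]; rewrite inE.
have [T clT aT] := subform_closed1 a.
exists (T `|` S); first exact: subform_closedU.
move=> c; rewrite !inE => /orP[/eqP->|/sS->]; rewrite ?aT ?orbT //.
Qed.

(** * Maximal unprovable pairs *)

Section CanonicalModel.
Variable S : {fset form}.
Hypothesis clS : subform_closed S.

Definition fpair : Type := ({fset form} * {fset form})%type.

Implicit Types (l : level) (p q : fpair).

Definition unprovable l p := ~ GLSseq_cutfree_provable (Sequent l p.1 p.2).

Record maximal l p : Prop := Maximal {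
  max_subl : p.1 `<=` S;
  max_subr : p.2 `<=` S;
  max_unprov : unprovable l p;
  max_left : forall a, a \in S -> unprovable l (a |` p.1, p.2) -> a \in p.1;
  max_right : forall a, a \in S -> unprovable l (p.1, p.2 `|` [fset a]) ->
    a \in p.2 }.

(** Each addition that keeps the pair unprovable lowers the number of formulas of [S] missing from
    the two sides, so the process stops. *)
Lemma maximal_extension l p :
  p.1 `<=` S -> p.2 `<=` S -> unprovable l p ->
  exists q, [/\ maximal l q, p.1 `<=` q.1 & p.2 `<=` q.2].
Proof.
have [n] := ubnP (#|` S `\` p.1| + #|` S `\` p.2|).
elim: n p => // n IHn p; rewrite ltnS => le_n p1 p2 up.
have shrink (A : {fset form}) a : a \in S -> a \notin A ->
    #|` S `\` (a |` A)| < #|` S `\` A|.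
  move=> aS aA; apply: (@fcard_ltn _ _ a); rewrite ?inE ?eqxx ?aS ?aA //.
  by apply/fsubsetP => c; rewrite !inE negb_or -andbA => /and3P[_ -> ->].
have [[a [aS ua na]]|nl] :=
  EM (exists a, [/\ a \in S, unprovable l (a |` p.1, p.2) & a \notin p.1]).
  have [||//|//|q [mq /= q1 q2]] := IHn (a |` p.1, p.2).
  - apply: leq_trans le_n; rewrite /= ltn_add2r; exact: shrink.
  - by rewrite /= fsubUset fsub1set aS.
  by exists q; split=> //; apply: fsubset_trans q1; apply: fsubsetUr.
have [[a [aS ua na]]|nr] := EM (exists a,
    [/\ a \in S, unprovable l (p.1, p.2 `|` [fset a]) & a \notin p.2]).
  have [|//||//|q [mq /= q1 q2]] := IHn (p.1, p.2 `|` [fset a]).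
  - apply: leq_trans le_n; rewrite /= ltn_add2l fsetUC; exact: shrink.
  - by rewrite /= fsubUset fsub1set aS p2.
  by exists q; split=> //; apply: fsubset_trans q2; apply: fsubsetUl.
exists p; split=> //; split=> // a aS ua.
  by apply/negPn/negP => na; apply: nl; exists a.
by apply/negPn/negP => na; apply: nr; exists a.
Qed.

Section MaximalPair.
Variables (l : level) (p : fpair).
Hypothesis mp : maximal l p.

Lemma maximal_bot : Bot \notin p.1.
Proof.
apply/negP => bp; apply: (max_unprov mp).
by apply: GLS_weak (GLS_bot _ l); rewrite ?fsub1set ?fsub0set.
Qed.

Lemma maximal_disjoint a : a \in p.1 -> a \in p.2 -> False.
Proof.
move=> a1 a2; apply: (max_unprov mp).
by apply: GLS_weak (GLS_id _ l a); rewrite fsub1set.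
Qed.

(** Since the comma is union, both premises of [GLS_impL] may keep the principal formula; if neither
    alternative held, maximality would prove both premises. *)
Lemma maximal_impl a b : Imp a b \in p.1 -> a \in p.2 \/ b \in p.1.
Proof.
move=> ip; have iS := fsubsetP (max_subl mp) _ ip.
have [aS bS] := clS.1 _ _ iS; apply: contrapT => /not_orP[na nb].
apply: (max_unprov mp); rewrite /GLSseq_cutfree_provable.
rewrite -(mem_fset1U ip); apply: GLS_impL.
  by apply: contrapT => /(max_right mp aS).
by apply: contrapT => /(max_left mp bS).
Qed.

(** By [GLS_impR] the pair enlarged by both formulas is unprovable; weakening passes this to each
    single enlargement. *)
Lemma maximal_impr a b : Imp a b \in p.2 -> a \in p.1 /\ b \in p.2.
Proof.
move=> ip; have iS := fsubsetP (max_subr mp) _ ip.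
have [aS bS] := clS.1 _ _ iS.
have ab : unprovable l (a |` p.1, p.2 `|` [fset b]).
  move=> pr; apply: (max_unprov mp).
  have -> : p.2 = p.2 `|` [fset Imp a b] by rewrite fsetUC mem_fset1U.
  exact: GLS_impR.
split.
  apply: (max_left mp aS) => pr; apply: ab.
  by apply: GLS_weak pr; rewrite ?fsubsetUl.
apply: (max_right mp bS) => pr; apply: ab.
by apply: GLS_weak pr; rewrite ?fsubsetUr.
Qed.

End MaximalPair.

Lemma maximal_boxl p a : maximal Second p -> Box a \in p.1 -> a \in p.1.
Proof.
move=> mp bp; have bS := fsubsetP (max_subl mp) _ bp.
apply: (max_left mp (clS.2 _ bS)) => pr; apply: (max_unprov mp).
by rewrite /GLSseq_cutfree_provable -(mem_fset1U bp); apply: GLS_boxL.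
Qed.

(** The second clause demands a new box on the left, which excludes infinite ascents inside the
    finite set [S]. *)
Definition canon_acc p q : Prop :=
  (forall a, Box a \in p.1 -> a \in q.1 /\ Box a \in q.1) /\
  (exists2 a, Box a \in q.1 & Box a \notin p.1).

Lemma canon_acc_trans p q r : canon_acc p q -> canon_acc q r -> canon_acc p r.
Proof.
move=> [pq _] [qr [a ar aq]]; split=> [b /pq[_ /qr]//|].
by exists a => //; apply: contra aq => /pq[].
Qed.

(** Were the premise of [GLS_boxGL] for [Box a] provable, [p] would be too. So the premise extends
    to a maximal pair, and [Box a] itself is the new box on its left. *)
Lemma maximal_boxr l p a : maximal l p -> Box a \in p.2 ->
  exists q, [/\ maximal First q, canon_acc p q & a \in q.2].
Proof.
move=> mp bp; have bS := fsubsetP (max_subr mp) _ bp.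
(* Filtering by [S] only ensures finiteness: no body is lost, as [S] is subformula-closed. *)
pose G := [fset b in S | Box b \in p.1].
have GE b : (b \in G) = (Box b \in p.1).
  rewrite !inE /= andbC; case: (boolP (Box b \in p.1)) => //= bp1.
  exact: clS.2 (fsubsetP (max_subl mp) _ bp1).
have bG : boxes G `<=` p.1.
  by apply/fsubsetP => c /imfsetP[b /= bG ->]; rewrite -GE.
have [|||q [mq /= q1 q2]] :=
    @maximal_extension First (G `|` boxes G `|` [fset Box a], [fset a]).
- rewrite /= !fsubUset fsub1set bS (fsubset_trans bG (max_subl mp)) !andbT.
  by apply/fsubsetP => b; rewrite !inE => /andP[].
- by rewrite /= fsub1set; apply: clS.2.
- move=> /GLS_boxGL pr; apply: (max_unprov mp).
  have {}pr : GLSseq_cutfree_provable (Sequent l (boxes G) [fset Box a]).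
    by case: (l) => //; apply: GLS_lift.
  by apply: GLS_weak pr; rewrite ?fsub1set.
exists q; split=> //; last by rewrite -fsub1set.
split=> [b|].
  rewrite -GE => bInG.
  by split; apply: (fsubsetP q1); rewrite !in_fsetU ?boxes_mem bInG ?orbT.
exists a; first by apply: (fsubsetP q1); rewrite !inE eqxx !orbT.
by apply/negP => /(maximal_disjoint mp); apply.
Qed.

(** * The canonical model with a chain of copies below it *)

Variable p0 : fpair.
Hypothesis mp0 : maximal Second p0.

(* [inl q] is a pair of the canonical model, live only if it is maximal;
   [inr n] is the n-th copy of [p0]. *)
Definition cworld : Type := (fpair + nat)%type.

Definition label (w : cworld) : fpair := if w is inl p then p else p0.

Definition clevel (w : cworld) : level := if w is inl _ then First else Second.

(** The target is matched first: a pair and a copy see the maximal successors of their label by the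
    same clause. *)
Definition cacc (v w : cworld) : Prop :=
  match w, v with
  | inl q, _ => maximal First q /\ canon_acc (label v) q
  | inr m, inr n => m < n
  | inr _, inl _ => False
  end.

Lemma cacc_trans u v w : cacc u v -> cacc v w -> cacc u w.
Proof.
case: w v u => [r|k] [q|m] [p|n] //=.
- by move=> [_ pq] [mr qr]; split=> //; apply: canon_acc_trans qr.
- by move=> [_ pq] [mr qr]; split=> //; apply: canon_acc_trans qr.
- by move=> nm mk; apply: ltn_trans nm.
Qed.

(** The offset, one more than the size of [S], puts every copy above every pair. *)
Definition cheight (w : cworld) : nat :=
  match w with
  | inl p => #|` [fset a in S | Box a \notin p.1]|
  | inr n => n + #|` S|.+1
  end.

Lemma cheight_lt v w : cacc v w -> cheight w < cheight v.
Proof.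
case: w v => [q|m] [p|n] //=; last by rewrite ltn_add2r.
- move=> [mq [pq [a aq ap]]]; apply: (@fcard_ltn _ _ a); last 2 first.
  + rewrite !inE /= ap andbT; exact: clS.2 (fsubsetP (max_subl mq) _ aq).
  + by rewrite !inE /= aq andbF.
  apply/fsubsetP => b; rewrite !inE /= => /andP[-> /= nbq].
  by apply: contra nbq => /pq[].
- move=> _; rewrite addnS ltnS (leq_trans _ (leq_addl _ _)) //.
  by apply/fsubset_leq_card/fsubsetP => b; rewrite !inE => /andP[].
Qed.

Lemma cacc_noetherian : ~ exists x : nat -> cworld, forall n, cacc (x n) (x n.+1).
Proof.
case=> x xP; apply: (@no_descending_nat (cheight \o x)) => n.
exact: cheight_lt.
Qed.

Fixpoint cval (w : cworld) (a : form) : bool :=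
  match a with
  | Var _ => a \in (label w).1
  | Bot => false
  | Imp b c => cval w b ==> cval w c
  | Box b => `[< forall v, cacc w v -> cval v b >]
  end.

Lemma cval_imp w a b :
  cval w (Imp a b) = true <-> cval w a = false \/ cval w b = true.
Proof. by rewrite /=; case: (cval w a) (cval w b) => [] []; intuition. Qed.

Lemma cval_box w a :
  cval w (Box a) = true <-> forall v, cacc w v -> cval v a = true.
Proof. by split=> /asboolP. Qed.

Definition cmodel : GLmodel := {|
  world := cworld;
  world_nonempty := inhabits (inr 0);
  acc := cacc;
  acc_trans := cacc_trans;
  acc_noetherian := cacc_noetherian;
  val_of := cval;
  val_bot := fun=> erefl;
  val_imp := cval_imp;
  val_box := cval_box |}.

Lemma cacc_maximal v w : cacc v w -> maximal (clevel w) (label w).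
Proof. by case: w => [q []|]. Qed.

(** A formula of [S] may lie on neither side, so each side gives only one implication. Maximality is
    assumed since [cworld] contains arbitrary pairs. *)
Lemma truth_lemma a w : maximal (clevel w) (label w) ->
  (a \in (label w).1 -> cval w a) /\ (a \in (label w).2 -> ~~ cval w a).
Proof.
elim: a w => [n||a IHa b IHb|a IHa] w mw.
- split=> //= n2; apply/negP => n1; exact: (maximal_disjoint mw n1 n2).
- by split=> //; rewrite (negbTE (maximal_bot mw)).
- have [a1 a2] := IHa w mw; have [b1 b2] := IHb w mw; split=> /=.
    by case/(maximal_impl mw) => [/a2/negbTE->|/b1->]; rewrite ?implybT.
  by case/(maximal_impr mw) => [/a1-> /b2].
- split=> bw /=.
    apply/asboolP => v wv; apply: (IHa v (cacc_maximal wv)).1.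
    case: v w wv bw mw => [q|m] [p|n] //=; try by move=> [_ [pq _]] /pq[].
    (* Both worlds are copies with label [p0], so the body must lie on the left of [p0] itself. *)
    by move=> _ bp mp; apply: maximal_boxl bp.
  have [q [mq wq aq]] := maximal_boxr mw bw.
  apply/asboolP => /(_ (inl q)) H.
  by have := (IHa (inl q) mq).2 aq; rewrite H.
Qed.

End CanonicalModel.

(** * Cut-free completeness and the cycle of implications *)

Lemma cutfree_complete (Psi Phi : {fset form}) :
  (forall (M : GLmodel) (w : nat -> M), descending w ->
     exists i : nat, sequent_true (w i) (Psi ==>2 Phi)) ->
  GLSseq_cutfree_provable (Psi ==>2 Phi).
Proof.
move=> H; apply: contrapT => npr.
have [S clS] := subform_closure (Psi `|` Phi).
rewrite fsubUset => /andP[PsiS PhiS].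
have [p [mp /= /fsubsetP sPsi /fsubsetP sPhi]] :=
  @maximal_extension S Second (Psi, Phi) PsiS PhiS npr.
(* The copies form the descending sequence: copy [n.+1] sees copy [n]. *)
have [|i] := H (cmodel clS p) (fun n => inr n); first by move=> n /=.
have tl a := @truth_lemma S clS p mp a (inr i) mp.
by case=> -[a /= aP]; [have := (tl a).1 (sPsi _ aP) => /= ->
  | have := (tl a).2 (sPhi _ aP) => /= /negbTE->].
Qed.

Theorem theorem3p1 (Psi Phi : {fset form}) :
  [<-> exists Sigma : {fset form}, forall (M : GLmodel) (w : M),
         reflexive_at Sigma w -> sequent_true w (Psi ==>2 Phi);
       forall M : GLmodel, exists Sigma : {fset form}, forall w : M,
         reflexive_at Sigma w -> sequent_true w (Psi ==>2 Phi);
       forall (M : GLmodel) (w : nat -> M), descending w ->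
         exists i : nat, forall j : nat, i <= j ->
           sequent_true (w j) (Psi ==>2 Phi);
       forall (M : GLmodel) (w : nat -> M), descending w ->
         exists i : nat, sequent_true (w i) (Psi ==>2 Phi);
       GLSseq_cutfree_provable (Psi ==>2 Phi);
       GLSseq_provable (Psi ==>2 Phi)].
Proof.
tfae.
- by move=> [Sigma H] M; exists Sigma; apply: H.
- move=> H M w dw; have [Sigma HS] := H M.
  by have [i iP] := descending_reflexive Sigma dw; exists i => j /iP/HS.
- by move=> H M w /H[i iP]; exists i; apply: iP.
- exact: cutfree_complete.
- exact: GLSseq_cut_mono.
(* At the second level [valid_at] computes to the first condition. *)
- by move=> /GLSseq_sound[Sigma HS]; exists Sigma.
Qed.
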